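(* Let $\epsilon, \Delta, D$, and $L_1$ be positive. Then $$ \mathcal{T}_\epsilon\big(\mathcal{A}_{\mathrm{det}}^{(1)}, \mathcal{F}^{\mathrm{conv}}(\Delta, L_1)\big) \ge \mathcal{T}_\epsilon\big(\mathcal{A}_{\mathrm{zr}}^{(1)}, \mathcal{Q}(\Delta, L_1)\big) \ge \frac{\sqrt{L_1\Delta}}{4}\,\epsilon^{-1}, $$ and $$ \mathcal{T}_\epsilon\big(\mathcal{A}_{\mathrm{det}}^{(1)}, \mathcal{F}^{\mathrm{conv,dist}}(D, L_1)\big) \ge \mathcal{T}_\epsilon\big(\mathcal{A}_{\mathrm{zr}}^{(1)}, \mathcal{Q}^{\mathrm{dist}}(D, L_1)\big) \ge \frac{\sqrt{L_1 D}}{2}\,\epsilon^{-1/2}. $$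
   Context: Here $\mathbb{N}=\{1,2,\ldots\}$ and $\|\cdot\|$ is the Euclidean norm. Function classes. $\mathcal{F}^{\mathrm{conv}}(\Delta,L_1)$ is the union, over $d\in\mathbb{N}$, of the collections of $\mathcal{C}^\infty$ convex functions $f:\mathbb{R}^d\to\mathbb{R}$ with $L_1$-Lipschitz gradient and $f(0)-\inf_x f(x)\le\Delta$. $\mathcal{Q}(\Delta,L_1)\subset \mathcal{F}^{\mathrm{conv}}(\Delta,L_1)$ is the set of convex quadratic functions satisfying these conditions. $\mathcal{F}^{\mathrm{conv,dist}}(D,L_1)$ is the union, over $d\in\mathbb{N}$, of the collections of $\mathcal{C}^\infty$ convex functions $f:\mathbb{R}^d\to\mathbb{R}$ with $L_1$-Lipschitz gradient satisfying $\|x^\star\|\le D$ for all $x^\star\in\arg\min_x f(x)$. $\mathcal{Q}^{\mathrm{dist}}(D,L_1)\subset \mathcal{F}^{\mathrm{conv,dist}}(D,L_1)$ is the set of convex quadratic functions satisfying these conditions. Algorithms. An algorithm $\mathsf{A}$ maps (separately for every dimension $d$) functions $f:\mathbb{R}^d\to\mathbb{R}$ to sequences of iterates $\mathsf{A}[f]=\{x^{(t)}\}_{t\in\mathbb{N}}$ in $\mathbb{R}^d$. $\mathcal{A}_{\mathrm{det}}^{(1)}$ (first-order deterministic algorithms) is the set of algorithms whose iterates have the form $x^{(i)}=\mathsf{A}^{(i)}\big(f(x^{(1)}),\nabla f(x^{(1)}),\ldots,f(x^{(i-1)}),\nabla f(x^{(i-1)})\big)$ for all $i\in\mathbb{N}$,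 with $\mathsf{A}^{(i)}$ a measurable mapping into $\mathbb{R}^d$ (depending on $d$ but not otherwise on $f$). For $v\in\mathbb{R}^d$ let $\mathrm{supp}(v)=\{i: v_i\ne 0\}$. $\mathcal{A}_{\mathrm{zr}}^{(1)}$ (first-order zero-respecting algorithms) is the set of algorithms such that for every $d$ and $f:\mathbb{R}^d\to\mathbb{R}$ the iterates $\{x^{(t)}\}=\mathsf{A}[f]$ satisfy $\mathrm{supp}(x^{(t)})\subseteq\bigcup_{s<t}\mathrm{supp}(\nabla f(x^{(s)}))$ for each $t\in\mathbb{N}$ (in particular $x^{(1)}=0$). Complexity. $\mathsf{T}_\epsilon(\mathsf{A},f)=\inf\{t\in\mathbb{N}: \|\nabla f(x^{(t)})\|\le\epsilon\}$ where $\{x^{(t)}\}=\mathsf{A}[f]$ (infimum of the empty set is $\infty$), and for an algorithm class $\mathcal{A}$ and function class $\mathcal{F}$, $\mathcal{T}_\epsilon(\mathcal{A},\mathcal{F})=\inf_{\mathsf{A}\in\mathcal{A}}\sup_{f\in\mathcal{F}}\mathsf{T}_\epsilon(\mathsf{A},f)$. *)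

(* Defs.v *)
From HB Require Import structures.
From mathcomp Require Import all_boot all_order all_algebra.
From mathcomp Require Import all_classical all_reals all_analysis.

Set Implicit Arguments.
Unset Strict Implicit.
Unset Printing Implicit Defensive.

Import Order.TTheory GRing.Theory Num.Theory.
Import numFieldNormedType.Exports.

Local Open Scope classical_set_scope.
Local Open Scope ring_scope.

(* A dimension d >= 1 is written n.+1, and a sequence indexed by {1, 2, ...} is
   indexed here from 0: the t-th iterate x^(t) is [x t.-1].                   *)

Section Functions.
Context {R : realType} {n : nat}.
Local Notation E := 'rV[R]_n.+1.
Implicit Types (f : E -> R) (x y v : E).

(* The library norm on row vectors is the sup norm. *)
Definition eucl_norm v : R := Num.sqrt (\sum_i v 0 i ^+ 2).

Definition partial (i : 'I_n.+1) f : E -> R := 'D_(delta_mx 0 i) f.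

Definition grad f x : E := \row_i partial i f x.

Definition smooth f : Prop :=
  forall s : seq 'I_n.+1, let g := foldr partial f s in
    (forall x i, derivable g x (delta_mx 0 i)) /\ continuous g.

Definition lipschitz_grad (L : R) f : Prop :=
  forall x y, eucl_norm (grad f x - grad f y) <= L * eucl_norm (x - y).

Definition argmin f : set E := [set x | forall y, f x <= f y].

(* The infimum is -oo when f is unbounded below, in which case the left-hand
   side is +oo.                                                               *)
Definition gap_le (Delta : R) f : Prop :=
  ((f 0)%:E - ereal_inf (range (EFin \o f)) <= Delta%:E)%E.

Definition dist_le (D : R) f : Prop :=
  forall x, argmin f x -> eucl_norm x <= D.

Definition quadratic f : Prop :=
  exists (H : 'M[R]_n.+1) (b : E) (c : R),
    forall x, f x = (x *m H *m x^T + b *m x^T) 0 0 + c.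

Definition supp v : set 'I_n.+1 := [set i | v 0 i != 0].

End Functions.

Section Complexity.
Context {R : realType}.

Definition function_class : Type := forall n, set ('rV[R]_n.+1 -> R).

Definition Fconv (Delta L1 : R) : function_class := fun n =>
  [set f : 'rV[R]_n.+1 -> R | [/\ smooth f, convex_function setT f,
     lipschitz_grad L1 f & gap_le Delta f]].

Definition Fconv_dist (D L1 : R) : function_class := fun n =>
  [set f : 'rV[R]_n.+1 -> R | [/\ smooth f, convex_function setT f,
     lipschitz_grad L1 f & dist_le D f]].

Definition Qconv (Delta L1 : R) : function_class := fun n =>
  Fconv Delta L1 (n := n) `&` quadratic.

Definition Qconv_dist (D L1 : R) : function_class := fun n =>
  Fconv_dist D L1 (n := n) `&` quadratic.

(* [dist_le] holds vacuously for a function without minimizers, such as a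
   nonconstant linear one; this is the subclass of functions having one.      *)
Definition attaining (F : function_class) : function_class := fun n =>
  F n `&` [set f | argmin f !=set0].

Definition algorithm : Type :=
  forall n, ('rV[R]_n.+1 -> R) -> nat -> 'rV[R]_n.+1.

Definition response n (f : 'rV[R]_n.+1 -> R) (x : 'rV[R]_n.+1) :
  'rV[R]_(1 + n.+1) := row_mx (f x)%:M (grad f x).

Definition borel_measurable (T U : ptopologicalType) (g : T -> U) : Prop :=
  measurable_fun setT
    (g : g_sigma_algebraType (@open T) -> g_sigma_algebraType (@open U)).

(* The responses to the first t queries are the rows of a t x (1 + d) matrix. *)
Definition A_det : set algorithm := [set A |
  exists2 step : forall n t, 'M[R]_(t, 1 + n.+1) -> 'rV[R]_n.+1,
    forall n t, borel_measurable (@step n t) &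
    forall n (f : 'rV[R]_n.+1 -> R) t,
      A n f t = step n t (\matrix_(s < t) response f (A n f s))].

(* Where f has no gradient, [grad] takes arbitrary values. This does not affect
   the complexity of a class of smooth functions: an algorithm that is
   zero-respecting on those can be redefined as 0 on all other functions.     *)
Definition A_zr : set algorithm := [set A |
  forall n (f : 'rV[R]_n.+1 -> R) t,
    supp (A n f t) `<=` \bigcup_(s in `I_t) supp (grad f (A n f s))].

Definition Teps (eps : R) (A : algorithm) n (f : 'rV[R]_n.+1 -> R) : \bar R :=
  ereal_inf [set t.+1%:R%:E | t in
    [set t | eucl_norm (grad f (A n f t)) <= eps]].

Definition complexity (eps : R) (AA : set algorithm) (F : function_class) :
    \bar R :=
  ereal_inf [set ereal_sup (\bigcup_n [set Teps eps A f | f in F n]) | A in AA].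

End Complexity.

(* Main.v *)
Require Import Defs.
From mathcomp Require Import all_boot all_order all_algebra.
From mathcomp Require Import all_classical all_reals all_analysis.
From mathcomp Require Import ring lra.

Import Order.TTheory GRing.Theory Num.Theory.
Import numFieldNormedType.Exports.

Local Open Scope classical_set_scope.
Local Open Scope ring_scope.

(** Two independent arguments are combined.

    _Comparison of the two algorithm classes._ Let [A] be a deterministic
    first-order algorithm and [f] a quadratic function in dimension [d]. For a
    matrix [V] with [d] orthonormal rows of length [N], the function
    [[
      orth_ext L V f x = f (x V^T) + L / 2 * (|x|^2 - |x V^T|^2)
    ]]
    in dimension [N] is [f] along the row space of [V] and the isotropic
    quadratic of curvature [L] on the orthogonal complement. It satisfies every
    condition on [f] that defines the classes at hand: quadratic, convex, with
    [L]-Lipschitz gradient, with the same gap, and with minimizers of the same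
    norm. The last point needs [0 < L]: without the second term the minimizers
    would form unbounded affine subspaces. Its gradient at [x] is at least as
    long as the gradient of [f] at [x V^T].

    For [N] large enough, the rows of [V] can be chosen adaptively so that the
    projected queries [z_t = x_t V^T] of [A] on [orth_ext L V f] respect the
    zeros of [f] during any prescribed number [T] of steps
    ([exists_zero_respecting_frame]). Indeed the answers to the queries before
    time [t] only involve the rows of [V] with index in the supports of the
    gradients of [f] at [z_0, ..., z_(t-1)]; the other rows can be replaced by
    vectors orthogonal to the queries [x_0, ..., x_t], which does not change
    these queries. Running [A] on this function and projecting is a
    zero-respecting algorithm that is no slower on [f] than [A] is on
    [orth_ext L V f] ([complexity_zr_le_det]).

    _Lower bound for zero-respecting algorithms._ The hard function in dimension
    [n + 1] is
    [[
      chain x = lam / 2 * (a^2 (x_0 - s)^2 + sum_(k < n) (x_k - x_(k+1))^2).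
    ]]
    A gradient computed at a point supported on the first [t] coordinates is
    supported on the first [t + 1] ones, so the last coordinate of a
    zero-respecting iterate vanishes for the first [n + 1] queries. At such
    points the gradient has inner product [- lam s] with the vector
    [v_i = a^-2 + i], so Cauchy-Schwarz bounds its norm from below
    ([grad_chain_ge]). The two bounds come from [lam = L / 4] together with
    [a = 1], [s^2 = D^2 / (n + 1)] when the norm of the minimizer is bounded,
    and [a^2 = 1 / (n + 1)], [s^2 = 8 Delta (n + 1) / L] when the gap is. *)

(** * Inner product and Euclidean norm *)

Section DotProduct.
Context {R : realType}.

(** The Euclidean inner product of row vectors. *)
Definition dot {n} (u v : 'rV[R]_n) : R := (u *m v^T) 0 0.

Lemma dotE {n} (u v : 'rV[R]_n) : dot u v = \sum_i u 0 i * v 0 i.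
Proof. by rewrite /dot mxE; apply: eq_bigr => i _; rewrite mxE. Qed.

Lemma dotC {n} (u v : 'rV[R]_n) : dot u v = dot v u.
Proof. by rewrite !dotE; apply: eq_bigr => i _; rewrite mulrC. Qed.

Lemma dotDl {n} (u v w : 'rV[R]_n) : dot (u + v) w = dot u w + dot v w.
Proof. by rewrite /dot mulmxDl mxE. Qed.

Lemma dotZl {n} a (u v : 'rV[R]_n) : dot (a *: u) v = a * dot u v.
Proof. by rewrite /dot -scalemxAl mxE. Qed.

Lemma dotNl {n} (u v : 'rV[R]_n) : dot (- u) v = - dot u v.
Proof. by rewrite /dot mulNmx mxE. Qed.

Lemma dotDr {n} (u v w : 'rV[R]_n) : dot u (v + w) = dot u v + dot u w.
Proof. by rewrite dotC dotDl !(dotC u). Qed.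

Lemma dotZr {n} a (u v : 'rV[R]_n) : dot u (a *: v) = a * dot u v.
Proof. by rewrite dotC dotZl dotC. Qed.

Lemma dotNr {n} (u v : 'rV[R]_n) : dot u (- v) = - dot u v.
Proof. by rewrite dotC dotNl dotC. Qed.

Lemma dot0l {n} (u : 'rV[R]_n) : dot 0 u = 0.
Proof. by rewrite /dot mul0mx mxE. Qed.

Definition dotLE := (@dotDl, @dotZl, @dotNl, @dotDr, @dotZr, @dotNr).

(** The transpose is the adjoint for the inner product. *)
Lemma dot_mull {m n : nat} (u : 'rV[R]_m) (A : 'M[R]_(m, n)) v :
  dot (u *m A) v = dot u (v *m A^T).
Proof. by rewrite /dot trmx_mul trmxK mulmxA. Qed.

Lemma dot_delta {n} (u : 'rV[R]_n) i : dot u (delta_mx 0 i) = u 0 i.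
Proof.
rewrite dotE (bigD1 i)//= big1 => [|j ji]; rewrite !mxE ?eqxx ?mulr1 ?addr0//.
by rewrite (negbTE ji) mulr0.
Qed.

Lemma dot_ge0 {n} (u : 'rV[R]_n) : 0 <= dot u u.
Proof. by rewrite dotE sumr_ge0// => i _; rewrite -expr2 sqr_ge0. Qed.

Lemma dot_eq0 {n} (u : 'rV[R]_n) : (dot u u == 0) = (u == 0).
Proof.
apply/eqP/eqP => [|->]; last by rewrite dot0l.
rewrite dotE => /eqP; rewrite psumr_eq0 => [|i _]; last first.
  by rewrite -expr2 sqr_ge0.
move=> /allP u0; apply/rowP => i; rewrite mxE; apply/eqP.
by have := u0 i (mem_index_enum _); rewrite mulf_eq0 orbb.
Qed.

Lemma dot_cauchy_schwarz {n} (u v : 'rV[R]_n) :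
  dot u v ^+ 2 <= dot u u * dot v v.
Proof.
have [v0|v_neq0] := eqVneq v 0; first by rewrite v0 dotC !dot0l expr0n mulr0.
have vv_gt0 : 0 < dot v v by rewrite lt_neqAle eq_sym dot_eq0 v_neq0 dot_ge0.
have := dot_ge0 (dot v v *: u - dot u v *: v).
rewrite !dotLE (dotC v u).
rewrite [X in 0 <= X](_ : _ = dot v v * (dot u u * dot v v - dot u v ^+ 2));
  last by ring.
by rewrite pmulr_rge0// subr_ge0.
Qed.

Lemma eucl_normE {n} (u : 'rV[R]_n.+1) : eucl_norm u = Num.sqrt (dot u u).
Proof. by rewrite dotE. Qed.

Lemma eucl_norm_le {n} (u : 'rV[R]_n.+1) a : 0 <= a ->
  (eucl_norm u <= a) = (dot u u <= a ^+ 2).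
Proof.
move=> a0; rewrite eucl_normE -{1}(ger0_norm a0) -sqrtr_sqr.
by rewrite ler_sqrt ?exprn_ge0 ?dot_ge0.
Qed.

(** The Lipschitz condition in terms of squared norms, free of square roots. *)
Lemma lipschitz_gradE {n} L (f : 'rV[R]_n.+1 -> R) : 0 <= L ->
  lipschitz_grad L f <-> forall x y, let g := grad f x - grad f y in
    dot g g <= L ^+ 2 * dot (x - y) (x - y).
Proof.
move=> L0; have normE x y :
    (eucl_norm (grad f x - grad f y) <= L * eucl_norm (x - y)) =
    (dot (grad f x - grad f y) (grad f x - grad f y) <=
       L ^+ 2 * dot (x - y) (x - y)).
  by rewrite eucl_norm_le ?mulr_ge0 ?sqrtr_ge0// exprMn [in LHS]eucl_normE
    sqr_sqrtr// dot_ge0.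
by split=> fL x y; have := fL x y; rewrite normE.
Qed.

End DotProduct.

(** * Quadratic functions *)

Section Quadratic.
Context {R : realType} {n : nat}.
Local Notation E := 'rV[R]_n.+1.
Implicit Types (H : 'M[R]_n.+1) (b x v : E) (c : R).

(** The quadratic function with (not necessarily symmetric) matrix [H], linear
    part [b] and constant term [c]; [qf_grad H b] is its gradient. *)
Definition qf H b c x : R := dot (x *m H) x + dot b x + c.

Lemma quadraticP (f : E -> R) :
  quadratic f <-> exists H b c, f = qf H b c.
Proof.
have qfE H b c x : (x *m H *m x^T + b *m x^T) 0 0 + c = qf H b c x.
  by rewrite mxE.
split=> [[H [b [c fE]]]|[H [b [c ->]]]]; exists H, b, c.
  by apply/funext => x; rewrite fE qfE.
by move=> x; rewrite qfE.
Qed.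

Definition qf_grad H b x := x *m (H + H^T) + b.

(** The exact second-order Taylor expansion; the derivatives and the convexity
    of quadratic functions are both read off from it. *)
Lemma qfD H b c x v : qf H b c (x + v) =
  qf H b c x + dot (qf_grad H b x) v + dot (v *m H) v.
Proof.
rewrite /qf /qf_grad mulmxDl mulmxDr !dotLE (dotC (x *m H^T) v).
by rewrite -[in RHS](trmxK H) -dot_mull trmxK; ring.
Qed.

Lemma qf_is_derive H b c x v :
  is_derive x v (qf H b c) (dot (qf_grad H b x) v).
Proof.
set g := dot _ v.
have gcvg : (fun h : R => h^-1 *: ((qf H b c \o shift x) (h *: v) - qf H b c x))
    @ 0^' --> g.
  have -> : g = g + 0 * dot (v *m H) v by rewrite mul0r addr0.
  (* The difference quotient is exactly [g + h * dot (v *m H) v]. *)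
  apply: (@cvg_trans _ ((fun h => g + h * dot (v *m H) v) @ 0^')).
    apply: near_eq_cvg; near=> h => /=.
    have h0 : h != 0 by near: h; exact: nbhs_dnbhs_neq.
    rewrite [_ *: v + x]addrC qfD -scalemxAl !(dotZl, dotZr) -/g /GRing.scale/=.
    by field.
  apply: cvg_within_filter.
  apply: cvgD; first exact: cvg_cst.
  by apply: cvgM; [exact: cvg_id|exact: cvg_cst].
by split; [apply/cvg_ex; exists g|apply: cvg_lim].
Unshelve. all: by end_near. Qed.

(** A partial derivative of a quadratic function is affine, hence of the form
    [qf 0 _ _]: the family is closed under iterated partial derivatives. *)
Lemma partial_qf H b c i :
  partial i (qf H b c) = qf 0 (row i (H + H^T)) (b 0 i).
Proof.
apply/funext => x; rewrite /partial.
rewrite (@derive_val _ _ _ _ _ _ _ (qf_is_derive H b c x _)).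
rewrite dot_delta /qf_grad mxE /qf mulmx0 dot0l add0r; congr (_ + _).
rewrite !dotE mxE; apply: eq_bigr => j _; rewrite !mxE mulrC; congr (_ * _).
by rewrite addrC.
Qed.

Lemma grad_qf H b c x : grad (qf H b c) x = qf_grad H b x.
Proof.
apply/rowP => i; rewrite mxE /partial.
by rewrite (@derive_val _ _ _ _ _ _ _ (qf_is_derive H b c x _)) dot_delta.
Qed.

Lemma continuous_dot (u w : E -> E) :
  (forall i, continuous (fun x => u x 0 i)) ->
  (forall i, continuous (fun x => w x 0 i)) ->
  continuous (fun x => dot (u x) (w x)).
Proof.
move=> cu cw.
have -> : (fun x => dot (u x) (w x)) = \sum_i (fun x => u x 0 i * w x 0 i).
  by apply/funext => x; rewrite dotE fct_sumE.
apply: (big_ind (fun f : E -> R => continuous f)).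
- exact: (@cst_continuous E R 0).
- by move=> f1 f2 f1c f2c x; exact: cvgD (f1c x) (f2c x).
- by move=> i _ x; exact: cvgM (cu i x) (cw i x).
Qed.

Lemma continuous_qf H b c : continuous (qf H b c).
Proof.
have cid i : continuous (fun x : E => x 0 i) by exact: coord_continuous.
have cM i : continuous (fun x : E => (x *m H) 0 i).
  have -> : (fun x : E => (x *m H) 0 i) = (fun x => dot x (row i H^T)).
    apply/funext => x; rewrite dotE mxE; apply: eq_bigr => j _.
    by rewrite !mxE.
  by apply: continuous_dot => // j; exact: cst_continuous.
have cb : continuous (fun x : E => dot b x).
  by apply: continuous_dot => // j; exact: cst_continuous.
move=> x; exact: cvgD (cvgD (continuous_dot _ _ cM cid x) (cb x))
                      (@cst_continuous E R c x).
Qed.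

Lemma smooth_qf H b c : smooth (qf H b c).
Proof.
move=> s /=.
have [H' [b' [c' ->]]] :
    exists H' b' c', foldr (@partial R n) (qf H b c) s = qf H' b' c'.
  elim: s => [|i s [H' [b' [c' IH]]]]; first by exists H, b, c.
  by exists 0, (row i (H' + H'^T)), (b' 0 i); rewrite /= IH partial_qf.
split=> [x i|]; last exact: continuous_qf.
exact: (@ex_derive _ _ _ _ _ _ _ (qf_is_derive H' b' c' x _)).
Qed.

Lemma smooth_quadratic (f : E -> R) : quadratic f -> smooth f.
Proof. by move=> /quadraticP[H [b [c ->]]]; exact: smooth_qf. Qed.

Lemma convex_functionP (f : E -> R) : convex_function setT f <->
  forall (t : R) x y, 0 <= t <= 1 ->
    f (t *: x + (1 - t) *: y) <= t * f x + (1 - t) * f y.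
Proof.
split=> [fc t x y t01|fc t x y _ _].
  have ti : t \in `[0, 1] by rewrite in_itv.
  have := fc (Itv01 (andP t01).1 (andP t01).2) x y (in_setT _) (in_setT _).
  by [].
apply: fc; apply/andP; split; [exact: ge0|exact: le1].
Qed.

Lemma convex_qf H b c : (forall v, 0 <= dot (v *m H) v) ->
  convex_function setT (qf H b c).
Proof.
move=> Hpsd; apply/convex_functionP => t x y /andP[t0 t1].
set z := t *: x + (1 - t) *: y; pose w := x - y.
have {1}-> : x = z + (1 - t) *: w.
  by apply/rowP => i; rewrite !mxE; ring.
have {1}-> : y = z + (- t) *: w.
  by apply/rowP => i; rewrite !mxE; ring.
rewrite !qfD -!scalemxAl !(dotZl, dotZr).
set q := qf _ _ _ _; set g := dot _ w; have := Hpsd w.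
set d := dot _ w => d0.
rewrite -subr_ge0 [X in 0 <= X](_ : _ = t * (1 - t) * d); last by ring.
by rewrite !mulr_ge0// subr_ge0.
Qed.

End Quadratic.

(** * Matrices with orthonormal rows *)

Section Orthonormal.
Context {R : realType}.

(** The rows of [V] form an orthonormal family. *)
Definition row_orthonormal {d N} (V : 'M[R]_(d, N)) := V *m V^T = 1%:M.

Lemma row_orthonormalP {d N} (V : 'M[R]_(d, N)) :
  row_orthonormal V <-> forall i j, dot (row i V) (row j V) = (i == j)%:R.
Proof.
have E i j : dot (row i V) (row j V) = (V *m V^T) i j.
  by rewrite dotE mxE; apply: eq_bigr => k _; rewrite !mxE.
split=> [VV i j|VV]; first by rewrite E VV mxE.
by apply/matrixP => i j; rewrite -E VV mxE.
Qed.

Lemma mulmx_trE {d N} (x : 'rV[R]_N) (V : 'M[R]_(d, N)) j :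
  (x *m V^T) 0 j = dot x (row j V).
Proof. by rewrite dotE mxE; apply: eq_bigr => k _; rewrite !mxE. Qed.

Lemma row_orthonormal_pid {d N} : (d <= N)%N ->
  row_orthonormal (pid_mx d : 'M[R]_(d, N)).
Proof.
by move=> dN; rewrite /row_orthonormal tr_pid_mx pid_mx_id// pid_mx_1.
Qed.

(** Fewer than [N] vectors of length [N] have a common unit normal vector. *)
Lemma exists_unit_kernel {p N} (M : 'M[R]_(p, N)) : (p < N)%N ->
  exists v : 'rV[R]_N, dot v v = 1 /\ forall i, dot v (row i M) = 0.
Proof.
move=> pN.
have ker0 : kermx M^T != 0.
  rewrite -mxrank_eq0 mxrank_ker subn_eq0 -ltnNge.
  exact: leq_ltn_trans (rank_leq_col _) pN.
pose v := nz_row (kermx M^T).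
have vv_gt0 : 0 < dot v v.
  by rewrite lt_neqAle eq_sym dot_eq0 nz_row_eq0 ker0 dot_ge0.
exists ((Num.sqrt (dot v v))^-1 *: v); split.
  by rewrite dotZl dotZr mulrA -invfM -expr2 sqr_sqrtr ?ltW// mulVf ?gt_eqF.
move=> i; rewrite dotZl -mulmx_trE.
by have /sub_kermxP -> := nz_row_sub (kermx M^T); rewrite mxE mulr0.
Qed.

(** If [N] is large enough, the rows of [V] with index in [l] can be replaced,
    one at a time, so as to become orthogonal to the rows of [W] while [V] stays
    orthonormal. *)
Lemma row_orthonormal_replace {d N k} (V : 'M[R]_(d, N)) (W : 'M[R]_(k, N))
    (l : seq 'I_d) : row_orthonormal V -> (d + k < N)%N ->
  exists V' : 'M[R]_(d, N), [/\ row_orthonormal V',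
    forall j, j \notin l -> row j V' = row j V &
    forall j i, j \in l -> dot (row i W) (row j V') = 0].
Proof.
move=> oV dkN; elim: l => [|j l [V' [/row_orthonormalP oV' V'V WV']]].
  by exists V.
have [v [vv vVW]] := exists_unit_kernel (col_mx V' W) dkN.
have vV i : dot v (row i V') = 0.
  by have := vVW (lshift k i); rewrite rowKu.
have vW i : dot v (row i W) = 0.
  by have := vVW (rshift d i); rewrite rowKd.
exists (\matrix_i (if i == j then v else row i V')); split.
- apply/row_orthonormalP => a b; rewrite !rowK.
  have [->|aj] := eqVneq a j; have [bj|bj] := eqVneq b j.
  + by rewrite vv.
  + by rewrite vV.
  + by rewrite dotC vV bj (negbTE aj).
  + exact: oV'.
- move=> a; rewrite inE negb_or => /andP[aj al].
  by rewrite rowK (negbTE aj) V'V.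
- move=> a i; rewrite inE rowK.
  have [_ _|_ /=] := eqVneq a j; first by rewrite dotC vW.
  exact: WV'.
Qed.

End Orthonormal.

(** * Extension of a function to a larger dimension *)

Section OrthogonalExtension.
Context {R : realType} {n N : nat} (L : R).
Implicit Types (V : 'M[R]_(n.+1, N.+1)) (f : 'rV[R]_n.+1 -> R).

(** [f] read along the rows of [V], plus [L / 2] times the squared distance to
    their span when [V] is orthonormal. *)
Definition orth_ext V f (x : 'rV[R]_N.+1) : R :=
  f (x *m V^T) + L / 2 * (dot x x - dot (x *m V^T) (x *m V^T)).

Lemma row_orthonormalK V (z : 'rV[R]_n.+1) :
  row_orthonormal V -> z *m V *m V^T = z.
Proof. by move=> oV; rewrite -mulmxA oV mulmx1. Qed.

Lemma dot_orthonormal V (z z' : 'rV[R]_n.+1) : row_orthonormal V ->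
  dot (z *m V) (z' *m V) = dot z z'.
Proof. by move=> oV; rewrite dot_mull row_orthonormalK. Qed.

Lemma dot_orthogonal V z (x : 'rV[R]_N.+1) : row_orthonormal V ->
  dot (z *m V) (x - x *m V^T *m V) = 0.
Proof.
by move=> oV; rewrite dot_mull mulmxBl row_orthonormalK// subrr dotC dot0l.
Qed.

(** Pythagoras' theorem for a vector [z *m V] of the span of the rows of [V] and
    a multiple of the component of [x] orthogonal to this span. *)
Lemma pythagoras V z (x : 'rV[R]_N.+1) a : row_orthonormal V ->
  let y := z *m V + a *: (x - x *m V^T *m V) in
  dot y y = dot z z +
    a ^+ 2 * dot (x - x *m V^T *m V) (x - x *m V^T *m V).
Proof.
move=> oV /=; move: (x - _) (dot_orthogonal V z x oV) => r zr.
rewrite !(dotDl, dotDr, dotZl, dotZr) (dotC r) zr dot_orthonormal//; ring.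
Qed.

Lemma dot_decomp V (x : 'rV[R]_N.+1) : row_orthonormal V ->
  dot x x - dot (x *m V^T) (x *m V^T) =
  dot (x - x *m V^T *m V) (x - x *m V^T *m V).
Proof.
move=> oV; have := pythagoras V (x *m V^T) x 1 oV.
rewrite /= scale1r addrC subrK => ->; ring.
Qed.

(** The map [z |-> z *m V] is a section of the projection [x |-> x *m V^T], and
    the extension restricts to [f] along it. *)
Lemma orth_ext_section V f z : row_orthonormal V -> orth_ext V f (z *m V) = f z.
Proof.
move=> oV; rewrite /orth_ext row_orthonormalK// dot_orthonormal//.
by rewrite subrr mulr0 addr0.
Qed.

(** Together with [orth_ext_section], this shows that [f] and its extension have
    the same infimum. *)
Lemma orth_ext_ge V f x : 0 <= L -> row_orthonormal V ->
  f (x *m V^T) <= orth_ext V f x.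
Proof.
by move=> L0 oV; rewrite lerDl mulr_ge0 ?divr_ge0// dot_decomp// dot_ge0.
Qed.

Lemma orth_ext_qf V H b c : orth_ext V (qf H b c) =
  qf (V^T *m H *m V + (L / 2) *: (1%:M - V^T *m V)) (b *m V) c.
Proof.
apply/funext => x; rewrite /orth_ext /qf.
rewrite mulmxDr -scalemxAr mulmxBr mulmx1 !mulmxA !(dotDl, dotZl, dotNl).
rewrite !(dot_mull _ V) -(dot_mull b); ring.
Qed.

Lemma quadratic_orth_ext V f : quadratic f -> quadratic (orth_ext V f).
Proof.
move=> /quadraticP[H [b [c ->]]]; apply/quadraticP.
by rewrite orth_ext_qf; do 3 eexists.
Qed.

Lemma grad_orth_ext V f x : quadratic f ->
  grad (orth_ext V f) x =
  grad f (x *m V^T) *m V + L *: (x - x *m V^T *m V).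
Proof.
move=> /quadraticP[H [b [c ->]]]; rewrite orth_ext_qf !grad_qf /qf_grad.
have -> : (V^T *m H *m V + (L / 2) *: (1%:M - V^T *m V))^T =
    V^T *m H^T *m V + (L / 2) *: (1%:M - V^T *m V).
  by rewrite linearD linearZ linearB/= !trmx_mul !trmxK trmx1 !mulmxA.
rewrite addrACA -scalerDl -splitr !mulmxDr -scalemxAr mulmxBr mulmx1.
by rewrite !mulmxDl !mulmxA addrAC.
Qed.

Lemma grad_orth_ext_ge V f x : row_orthonormal V -> quadratic f ->
  eucl_norm (grad f (x *m V^T)) <= eucl_norm (grad (orth_ext V f) x).
Proof.
move=> oV fq; rewrite eucl_norm_le ?sqrtr_ge0// eucl_normE sqr_sqrtr ?dot_ge0//.
by rewrite grad_orth_ext// pythagoras// lerDl mulr_ge0 ?sqr_ge0 ?dot_ge0.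
Qed.

Lemma convex_orth_ext V f : 0 <= L -> row_orthonormal V ->
  convex_function setT f -> convex_function setT (orth_ext V f).
Proof.
move=> L0 oV /convex_functionP fc.
have /convex_functionP rc : convex_function setT (orth_ext V (qf 0 0 0)).
  rewrite orth_ext_qf; apply: convex_qf => v.
  rewrite mulmx0 mul0mx add0r -scalemxAr dotZl mulr_ge0 ?divr_ge0//.
  rewrite mulmxBr mulmx1 !mulmxA dotDl dotNl (dot_mull _ V).
  by rewrite dot_decomp// dot_ge0.
apply/convex_functionP => t x y t01.
have := rc t x y t01; have := fc t (x *m V^T) (y *m V^T) t01.
rewrite /orth_ext /qf !mulmx0 !dot0l !addr0 !add0r mulmxDl -!scalemxAl.
lra.
Qed.

(** The gradient difference splits orthogonally into the part along the rows of
    [V], controlled by [f], and the complementary part, scaled by exactly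
    [L]. *)
Lemma lipschitz_orth_ext V f : 0 <= L -> row_orthonormal V -> quadratic f ->
  lipschitz_grad L f -> lipschitz_grad L (orth_ext V f).
Proof.
move=> L0 oV fq /(lipschitz_gradE _ _ L0) fL.
apply/(lipschitz_gradE _ _ L0) => x y /=; rewrite !grad_orth_ext//.
set gx := grad f _; set gy := grad f _.
have -> : gx *m V + L *: (x - x *m V^T *m V) -
    (gy *m V + L *: (y - y *m V^T *m V)) =
    (gx - gy) *m V + L *: ((x - y) - (x - y) *m V^T *m V).
  by rewrite !mulmxBl; apply/rowP => i; rewrite !mxE; ring.
have := fL (x *m V^T) (y *m V^T); rewrite -mulmxBl /= -/gx -/gy => fLxy.
rewrite pythagoras// -dot_decomp// mulrBr.
by rewrite addrCA gerDl subr_le0.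
Qed.

Lemma gap_orth_ext Delta V f : 0 <= L -> row_orthonormal V ->
  gap_le Delta f -> gap_le Delta (orth_ext V f).
Proof.
move=> L0 oV; apply: le_trans.
have -> : orth_ext V f 0 = f 0 by rewrite -(mul0mx _ V) orth_ext_section.
apply: leeB => //; apply/ereal_infP => _ [x _ <-].
apply: (@le_trans _ _ (f (x *m V^T))%:E).
  by apply: ereal_inf_lbound; exists (x *m V^T).
by rewrite lee_fin orth_ext_ge.
Qed.

(** A minimizer of the extension has no component orthogonal to the rows of [V],
    because [0 < L] penalizes it, so its norm is that of a minimizer of [f]. *)
Lemma dist_orth_ext D V f : 0 < L -> row_orthonormal V ->
  dist_le D f -> dist_le D (orth_ext V f).
Proof.
move=> L0 oV fD x minx.
have argx : argmin f (x *m V^T).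
  move=> z; rewrite -(orth_ext_section V f z oV); apply: le_trans (minx _).
  by apply: orth_ext_ge => //; exact: ltW.
have := minx (x *m V^T *m V); rewrite orth_ext_section// /orth_ext.
rewrite gerDl pmulr_rle0 ?divr_gt0// subr_le0 => xx.
apply: le_trans (fD _ argx); rewrite !eucl_normE.
by rewrite ler_sqrt// dot_ge0.
Qed.

Lemma argmin_orth_ext V f : 0 <= L -> row_orthonormal V ->
  argmin f !=set0 -> argmin (orth_ext V f) !=set0.
Proof.
move=> L0 oV [z minz]; exists (z *m V) => x; rewrite orth_ext_section//.
exact: le_trans (minz _) (orth_ext_ge _ _ _ L0 oV).
Qed.

End OrthogonalExtension.

(** * From deterministic to zero-respecting algorithms *)

Section Reduction.
Context {R : realType}.

(** The first [T] terms of the sequence [z] of queries to [f] only use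
    coordinates revealed by the earlier gradients. *)
Definition zero_respecting {n} (f : 'rV[R]_n.+1 -> R) (z : nat -> 'rV[R]_n.+1)
    (T : nat) :=
  forall t, (t < T)%N ->
    supp (z t) `<=` \bigcup_(s in `I_t) supp (grad f (z s)).

Lemma mulmx_eq_on_supp {d N} (u : 'rV[R]_d.+1) (V V' : 'M[R]_(d.+1, N)) :
  (forall i, supp u i -> row i V' = row i V) -> u *m V' = u *m V.
Proof.
move=> VV'; rewrite !mulmx_sum_row; apply: eq_bigr => i _.
have [->|ui] := eqVneq (u 0 i) 0; first by rewrite !scale0r.
by rewrite VV'.
Qed.

(** If the supports of [x *m V^T] and of the gradient of [f] there lie in [S],
    the response to the query [x] only depends on the rows of [V] with index in
    [S], provided that the other rows remain orthogonal to [x]. *)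
Lemma response_orth_ext_eq {n N} L (V V' : 'M[R]_(n.+1, N.+1)) f x
    (S : set 'I_n.+1) :
  quadratic f ->
  (forall i, S i -> row i V' = row i V) ->
  (forall i, ~ S i -> dot x (row i V') = 0) ->
  supp (x *m V^T) `<=` S -> supp (grad f (x *m V^T)) `<=` S ->
  x *m V'^T = x *m V^T /\
  response (orth_ext L V' f) x = response (orth_ext L V f) x.
Proof.
move=> fq VV' xV' zS gS.
have zE : x *m V'^T = x *m V^T.
  apply/rowP => i; have [Si|nSi] := pselect (S i).
    by rewrite !mulmx_trE VV'.
  rewrite mulmx_trE xV'//; apply/esym/eqP/negPn/negP => zi.
  exact/nSi/zS.
split=> //; congr (row_mx _ _).
  by rewrite /orth_ext zE.
rewrite !grad_orth_ext// zE.
rewrite (mulmx_eq_on_supp _ _ _ (fun i Si => VV' i (gS i Si))).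
by rewrite (mulmx_eq_on_supp _ _ _ (fun i Si => VV' i (zS i Si))).
Qed.

(** The adaptive choice of the rows of [V], by induction on the number [T] of
    steps: rows not yet revealed are made orthogonal to all queries so far. *)
Lemma exists_zero_respecting_frame (A : @algorithm R) L n N
    (f : 'rV[R]_n.+1 -> R) T :
  A_det A -> quadratic f -> (n.+1 + T <= N)%N ->
  exists V : 'M[R]_(n.+1, N.+1), row_orthonormal V /\
    zero_respecting f (fun t => A N (orth_ext L V f) t *m V^T) T.
Proof.
move=> [step _ Astep] fq.
elim: T => [|T IH] TN.
  exists (pid_mx n.+1); split=> //; apply: row_orthonormal_pid.
  by rewrite addn0 in TN; exact: leqW.
have {IH}[V [oV zrV]] := IH (leq_trans (leq_add (leqnn _) (leqnSn T)) TN).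
pose a V t := A N (orth_ext L V f) t.
pose z V t := a V t *m V^T.
(* The indices revealed so far; the other ones are listed in [l]. *)
pose S : set 'I_n.+1 := \bigcup_(s in `I_T) supp (grad f (z V s)).
pose W := \matrix_(s < T.+1) a V s.
pose l := [seq i <- enum 'I_n.+1 | ~~ `[< S i >]].
have lP i : (i \in l) = ~~ `[< S i >].
  by rewrite mem_filter mem_enum andbT.
have TN' : (n.+1 + T.+1 < N.+1)%N by [].
have [V' [oV' V'V WV']] := row_orthonormal_replace V W l oV TN'.
have VV'S i : S i -> row i V' = row i V.
  by move=> Si; apply: V'V; rewrite lP negbK; apply/asboolP.
have WV'S s i : (s <= T)%N -> ~ S i -> dot (a V s) (row i V') = 0.
  move=> sT nSi; have := WV' i (Ordinal (sT : (s < T.+1)%N)).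
  by rewrite rowK; apply; rewrite lP; apply/asboolP.
have zS s : (s < T)%N -> supp (z V s) `<=` S.
  move=> sT i /(zrV _ sT)[r rs gr]; exists r => //.
  exact: ltn_trans rs sT.
have gS s : (s < T)%N -> supp (grad f (z V s)) `<=` S.
  by move=> sT i gi; exists s.
(* By induction, the algorithm receives the same answers for [V'] as for [V], so
   it asks the same queries, up to and including query [T]. *)
have aE s : (s <= T)%N -> a V' s = a V s.
  elim/ltn_ind: s => s IHs sT; rewrite /a !Astep; congr (step N s _).
  apply/row_matrixP => r; rewrite !rowK.
  have rT := leq_trans (ltn_ord r) sT.
  have -> : A N (orth_ext L V' f) r = a V r by apply: IHs => //; exact: ltnW.
  have [] // := @response_orth_ext_eq n N L V V' f (a V r) S fq VV'S _ _ _.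
  - by move=> i; apply: WV'S; exact: ltnW.
  - exact: zS.
  - exact: gS.
have zE s : (s < T)%N -> z V' s = z V s.
  move=> sT; rewrite /z aE ?(ltnW sT)//.
  have [] // := @response_orth_ext_eq n N L V V' f (a V s) S fq VV'S _ _ _.
  - by move=> i; apply: WV'S; exact: ltnW.
  - exact: zS.
  - exact: gS.
exists V'; split => // t tT i zi.
have : (\bigcup_(s in `I_t) supp (grad f (z V s))) i.
  move: tT zi; rewrite ltnS leq_eqVlt => /orP[/eqP ->|tT].
    rewrite /supp /= -/(a V' T) aE// mulmx_trE => zi.
    have [//|nSi] := pselect (S i).
    by rewrite WV'S ?eqxx in zi.
  by rewrite -/(a V' t) -/(z V' t) zE// => zi; exact: (zrV t tT i).
move=> [s st gs]; exists s => //.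
have sT : (s < T)%N by exact: leq_trans st _.
by rewrite -/(a V' s) -/(z V' s) zE.
Qed.

Lemma Teps_le (eps : R) (A : algorithm) n (f : 'rV[R]_n.+1 -> R) t :
  eucl_norm (grad f (A n f t)) <= eps -> (Teps eps A f <= t.+1%:R%:E)%E.
Proof. by move=> ft; apply: ereal_inf_lbound; exists t. Qed.

(** The comparison for any two classes such that [F] consists of quadratic
    functions whose extensions belong to [F']. *)
Lemma complexity_zr_le_det (eps L : R) (F F' : @function_class R) :
  (forall n (f : 'rV[R]_n.+1 -> R), F n f -> quadratic f) ->
  (forall n N (V : 'M[R]_(n.+1, N.+1)) f, row_orthonormal V ->
     F n f -> F' N (orth_ext L V f)) ->
  (complexity eps A_zr F <= complexity eps A_det F')%E.
Proof.
move=> Fq FF'; apply/ereal_infP => _ [A Adet <-].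
set M := ereal_sup _.
have [->|Mfin] := eqVneq M +oo%E; first by rewrite leey.
have [T MT] : exists T : nat, (M < T.+1%:R%:E)%E.
  case: M Mfin => [r _|//|_]; last by exists 0%N; rewrite ltNyr.
  exists (Num.Def.truncn `|r|); rewrite lte_fin.
  by rewrite (le_lt_trans (ler_norm r))// truncnS_gt.
(* [T] steps suffice, because [A] reaches accuracy [eps] before time [T] on each
   function of [F']; [Z] is 0 from then on, and on functions that are not
   quadratic. *)
pose frame n (f : 'rV[R]_n.+1 -> R) (fq : quadratic f) := cid
  (exists_zero_respecting_frame A L n (n.+1 + T) f T Adet fq (leqnn _)).
pose Z : algorithm := fun n f t =>
  if pselect (quadratic f) is left fq then
    let V := sval (frame n f fq) in
    if (t < T)%N then A (n.+1 + T)%N (orth_ext L V f) t *m V^T else 0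
  else 0.
have Zzr : A_zr Z.
  move=> n f t; rewrite /Z.
  case: pselect => [fq|_]; last by move=> i; rewrite /supp /= mxE eqxx.
  case: ifPn => [tT|_]; last by move=> i; rewrite /supp /= mxE eqxx.
  case: (frame n f fq) => V [oV zrV] /= i /(zrV t tT)[s st gs].
  by exists s => //; rewrite (ltn_trans st tT).
apply: (@le_trans _ _
  (ereal_sup (\bigcup_n [set Teps eps Z f | f in F n]))).
  by apply: ereal_inf_lbound; exists Z.
apply/ereal_supP => _ [n _ [f Ff <-]].
have fq := Fq n f Ff.
pose V := sval (frame n f fq).
have [oV _] := svalP (frame n f fq).
set f' := orth_ext L V f.
have f'M : (Teps eps A f' <= M)%E.
  apply: ereal_sup_ubound; exists (n.+1 + T)%N => //.
  by exists f' => //; exact: FF'.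
apply: le_trans (f'M).
have early t : (t < T)%N -> eucl_norm (grad f' (A _ f' t)) <= eps ->
    (Teps eps Z f <= t.+1%:R%:E)%E.
  move=> tT ft; apply: Teps_le; rewrite /Z; case: pselect => [fq'|//].
  rewrite tT (Prop_irrelevance fq' fq); apply: le_trans ft.
  exact: grad_orth_ext_ge.
apply/ereal_infP => _ [t /= ft <-].
have [tT|Tt] := ltnP t T; first exact: early.
have [_ [s /= fs <-]] := ereal_inf_lt (le_lt_trans f'M MT).
rewrite lte_fin ltr_nat ltnS => sT.
apply: le_trans (early s sT fs) _.
by rewrite lee_fin ler_nat ltnS (leq_trans _ Tt)// ltnW.
Qed.

End Reduction.

(** * Least squares *)

Section LeastSquares.
Context {R : realType} {n : nat}.
Implicit Types (lam : R) (B : 'M[R]_n.+1) (t x w : 'rV[R]_n.+1).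

(** The least squares objective with system matrix [B] and target [t]. *)
Definition least_squares lam B t x : R :=
  lam / 2 * dot (x *m B - t) (x *m B - t).

Lemma least_squares_qf lam B t : least_squares lam B t =
  qf ((lam / 2) *: (B *m B^T)) (- lam *: (t *m B^T)) (lam / 2 * dot t t).
Proof.
apply/funext => x; rewrite /least_squares /qf.
rewrite -scalemxAr mulmxA !(dotDl, dotDr, dotNl, dotNr, dotZl).
by rewrite !(dot_mull _ B^T) trmxK (dotC (x *m B) t); field.
Qed.

Lemma quadratic_least_squares lam B t : quadratic (least_squares lam B t).
Proof. by apply/quadraticP; rewrite least_squares_qf; do 3 eexists. Qed.

Lemma grad_least_squares lam B t x :
  grad (least_squares lam B t) x = lam *: ((x *m B - t) *m B^T).
Proof.
rewrite least_squares_qf grad_qf /qf_grad linearZ/= trmx_mul trmxK -scalerDr.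
rewrite -scalemxAr mulmxDr scalerDr -scalerDl -splitr mulmxA mulmxBl scalerBr.
by rewrite scaleNr.
Qed.

Lemma convex_least_squares lam B t : 0 <= lam ->
  convex_function setT (least_squares lam B t).
Proof.
move=> lam0; rewrite least_squares_qf; apply: convex_qf => v.
by rewrite -scalemxAr dotZl mulmxA dot_mull trmxK mulr_ge0 ?dot_ge0// divr_ge0.
Qed.

(** If [|w B|^2 <= K |w|^2] for all [w], then the Hessian [lam *: (B *m B^T)] has
    operator norm at most [lam * K]: by Cauchy-Schwarz, [u = w B B^T] satisfies
    [|u|^4 <= |w B|^2 |u B|^2 <= K^2 |w|^2 |u|^2]. *)
Lemma lipschitz_least_squares lam B t K : 0 <= lam -> 0 <= K ->
  (forall w, dot (w *m B) (w *m B) <= K * dot w w) ->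
  lipschitz_grad (lam * K) (least_squares lam B t).
Proof.
move=> lam0 K0 BK; apply/lipschitz_gradE => [|x y /=]; first exact: mulr_ge0.
rewrite !grad_least_squares -scalerBr -mulmxBl opprB addrA subrK -mulmxBl.
set w := x - y; set u := w *m B *m B^T.
rewrite dotZl dotZr mulrA -expr2 exprMn -[leRHS]mulrA.
apply: ler_wpM2l; first exact: sqr_ge0.
have uu : dot u u = dot (w *m B) (u *m B) by rewrite {1}/u dot_mull trmxK.
have := dot_cauchy_schwarz (w *m B) (u *m B); rewrite -uu => CS.
have [u0|u_neq0] := eqVneq u 0.
  by rewrite u0 dot0l mulr_ge0 ?sqr_ge0// dot_ge0.
have uu_gt0 : 0 < dot u u by rewrite lt_neqAle eq_sym dot_eq0 u_neq0 dot_ge0.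
rewrite -(ler_pM2r uu_gt0) -expr2 (le_trans CS)//.
rewrite [leRHS](_ : _ = (K * dot w w) * (K * dot u u)); last by ring.
by rewrite ler_pM ?dot_ge0 ?BK.
Qed.

End LeastSquares.

(** * The hard chain function *)

Section Chain.
Context {R : realType} {n : nat} (lam a s : R).
Context (lam0 : 0 < lam) (a0 : 0 < a) (a1 : a <= 1).
Implicit Types x w : 'rV[R]_n.+1.

(** Column 0 of [chain_mx] reads [a * x_0] and column [j > 0] reads
    [x_(j-1) - x_j]; the target is [(a * s, 0, ..., 0)]. *)
Definition chain_mx : 'M[R]_n.+1 := \matrix_(i, j)
  if j == ord0 then a * (i == ord0)%:R
  else (i == inord j.-1)%:R - (i == j)%:R.

Definition chain_target : 'rV[R]_n.+1 := (a * s) *: delta_mx 0 ord0.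

(** The chain function
    [lam / 2 * (a^2 (x_0 - s)^2 + sum_k (x_k - x_(k+1))^2)]. *)
Definition chain := least_squares lam chain_mx chain_target.

Let sum_delta x k : \sum_i x 0 i * (i == k)%:R = x 0 k.
Proof.
rewrite (bigD1 k)//= eqxx mulr1 big1 ?addr0// => i /negbTE ->.
by rewrite mulr0.
Qed.

Lemma mul_chain_mx0 x : (x *m chain_mx) 0 ord0 = a * x 0 ord0.
Proof.
rewrite mxE -[in RHS](sum_delta x) mulr_sumr; apply: eq_bigr => i _.
by rewrite mxE eqxx mulrCA.
Qed.

Lemma mul_chain_mxS x (k : 'I_n) : (x *m chain_mx) 0 (lift ord0 k) =
  x 0 (widen_ord (leqnSn n) k) - x 0 (lift ord0 k).
Proof.
rewrite mxE -[in RHS](sum_delta x) -[X in _ - X](sum_delta x) -sumrB.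
apply: eq_bigr => i _; rewrite mxE lift_eqF mulrBr; congr (_ * (_ == _)%:R - _).
by apply: val_inj; rewrite /= add0n inordK// ltnS ltnW.
Qed.

Lemma chain_target0 : chain_target 0 ord0 = a * s.
Proof. by rewrite !mxE !eqxx mulr1. Qed.

Lemma chain_targetS (k : 'I_n) : chain_target 0 (lift ord0 k) = 0.
Proof. by rewrite !mxE mulr0. Qed.

(** Each square [(x_k - x_(k+1))^2] is at most [2 x_k^2 + 2 x_(k+1)^2], and
    every coordinate appears in at most two of the terms; as [a <= 1], the
    term [(a x_0)^2] is at most [x_0^2]. *)
Lemma chain_mx_norm w :
  dot (w *m chain_mx) (w *m chain_mx) <= 4 * dot w w.
Proof.
rewrite dotE big_ord_recl mul_chain_mx0.
have -> : dot w w = \sum_i w 0 i ^+ 2 by rewrite dotE.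
under eq_bigr do rewrite mul_chain_mxS.
have le_sum : \sum_(k < n) (w 0 (widen_ord (leqnSn n) k) - w 0 (lift ord0 k)) *
      (w 0 (widen_ord (leqnSn n) k) - w 0 (lift ord0 k)) <=
    2 * \sum_(k < n) w 0 (widen_ord (leqnSn n) k) ^+ 2 +
    2 * \sum_(k < n) w 0 (lift ord0 k) ^+ 2.
  rewrite !mulr_sumr -big_split/=; apply: ler_sum => k _.
  move: (w 0 _) (w 0 _) => p q; have := sqr_ge0 (p + q); nra.
have recl := @big_ord_recl R 0 +%R n (fun i => w 0 i ^+ 2).
have recr : \sum_i w 0 i ^+ 2 =
    \sum_(k < n) w 0 (widen_ord (leqnSn n) k) ^+ 2 + w 0 ord_max ^+ 2.
  by rewrite big_ord_recr.
have a2 : a * w 0 ord0 * (a * w 0 ord0) <= w 0 ord0 ^+ 2.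
  by rewrite mulrACA -!expr2 ler_piMl ?sqr_ge0// expr_le1// ltW//.
have := sqr_ge0 (w 0 ord0); have := sqr_ge0 (w 0 ord_max); lra.
Qed.

Lemma quadratic_chain : quadratic chain.
Proof. exact: quadratic_least_squares. Qed.

Lemma convex_chain : convex_function setT chain.
Proof. exact/convex_least_squares/ltW. Qed.

Lemma lipschitz_chain : lipschitz_grad (lam * 4) chain.
Proof.
by apply: lipschitz_least_squares; [exact: ltW| |exact: chain_mx_norm].
Qed.

Lemma chain_ge0 x : 0 <= chain x.
Proof. by rewrite mulr_ge0 ?dot_ge0// divr_ge0// ltW. Qed.

Lemma chain0 : chain 0 = lam / 2 * (a * s) ^+ 2.
Proof.
rewrite /chain /least_squares mul0mx sub0r dotNl dotNr opprK.
by rewrite dotZl dotZr dot_delta mxE !eqxx mulr1 -expr2.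
Qed.

Lemma chain_eq0 x : (chain x == 0) = (x == const_mx s).
Proof.
rewrite mulf_eq0 gt_eqF ?divr_gt0//= dot_eq0 subr_eq0.
apply/eqP/eqP => [xB|->]; last first.
  apply/rowP => j; case: (unliftP ord0 j) => [k|] ->.
    by rewrite mul_chain_mxS chain_targetS !mxE subrr.
  by rewrite mul_chain_mx0 chain_target0 mxE.
apply/rowP => -[i ltin]; rewrite mxE; elim: i ltin => [|i IH] ltin.
  have /rowP/(_ ord0) := xB; rewrite mul_chain_mx0 chain_target0.
  move/(mulfI (lt0r_neq0 a0)) <-; congr (x 0 _); exact: val_inj.
have /rowP/(_ (lift ord0 (Ordinal (ltin : (i < n)%N)))) := xB.
rewrite mul_chain_mxS chain_targetS => /eqP; rewrite subr_eq0 => /eqP.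
rewrite -(IH (ltnW ltin)) => xE; rewrite (_ : Ordinal (ltnW ltin) =
  widen_ord (leqnSn n) (Ordinal (ltin : (i < n)%N))); last exact: val_inj.
by rewrite xE; congr (x 0 _); exact: val_inj.
Qed.

Lemma argmin_chain : argmin chain = [set const_mx s].
Proof.
have chain_s : chain (const_mx s) = 0 by apply/eqP; rewrite chain_eq0.
apply/seteqP; split=> [x minx|_ -> x]; last by rewrite chain_s chain_ge0.
apply/eqP; rewrite -chain_eq0 eq_le chain_ge0 andbT -chain_s.
exact: minx.
Qed.

Lemma gap_chain Delta : lam / 2 * (a * s) ^+ 2 <= Delta -> gap_le Delta chain.
Proof.
move=> le_Delta; rewrite /gap_le -[leRHS]sube0; apply: leeB.
  by rewrite lee_fin chain0.
by apply/ereal_infP => _ [x _ <-]; rewrite lee_fin chain_ge0.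
Qed.

Lemma dist_chain D : 0 <= D -> n.+1%:R * s ^+ 2 <= D ^+ 2 -> dist_le D chain.
Proof.
move=> D0 sD x; rewrite argmin_chain => ->; rewrite eucl_norm_le// dotE.
under eq_bigr do rewrite mxE -expr2.
by rewrite sumr_const card_ord -mulr_natl.
Qed.

(** The gradient cannot be small where the last coordinate vanishes: the vector
    [v_i = a^-2 + i] is mapped by [chain_mx] to [(a^-1, -1, ..., -1)], so its
    inner product with the gradient telescopes to [lam * (x_n - s)]. *)
Lemma grad_chain_ge x : x 0 ord_max = 0 ->
  (lam * s) ^+ 2 <=
  n.+1%:R * (a ^- 2 + n%:R) ^+ 2 * dot (grad chain x) (grad chain x).
Proof.
move=> x0; pose v : 'rV[R]_n.+1 := \row_i (a ^- 2 + i%:R).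
have vB0 : (v *m chain_mx) 0 ord0 = a^-1.
  by rewrite mul_chain_mx0 mxE addr0; field; rewrite gt_eqF.
have vBS k : (v *m chain_mx) 0 (lift ord0 k) = - 1.
  by rewrite mul_chain_mxS !mxE lift0 /= -natr1; ring.
have telescope : dot (v *m chain_mx) (x *m chain_mx) = 0.
  rewrite dotE big_ord_recl vB0 mul_chain_mx0 mulKf ?gt_eqF//.
  under eq_bigr do rewrite vBS mul_chain_mxS mulN1r opprB.
  have := @big_ord_recl R 0 +%R n (fun i => x 0 i).
  rewrite big_ord_recr/= x0 addr0 => xE.
  by rewrite big_split/= sumrN addrA -xE subrr.
have vgrad : dot v (grad chain x) = - (lam * s).
  rewrite grad_least_squares dotZr dotC dot_mull trmxK dotC dotDr telescope.
  rewrite add0r dotNr dotZr dot_delta vB0; field; exact: lt0r_neq0.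
have := dot_cauchy_schwarz v (grad chain x); rewrite vgrad sqrrN.
move=> /le_trans; apply.
apply: ler_wpM2r; first exact: dot_ge0.
rewrite dotE -[n.+1 in leRHS]card_ord mulr_natl -sumr_const.
apply: ler_sum => i _; rewrite mxE -expr2 ler_sqr ?nnegrE.
- by rewrite lerD2l ler_nat -ltnS.
- by rewrite addr_ge0// invr_ge0 exprn_ge0// ltW.
- by rewrite addr_ge0// invr_ge0 exprn_ge0// ltW.
Qed.

(** A query reveals at most one new coordinate of the chain. *)
Lemma supp_grad_chain x t :
  (forall i : 'I_n.+1, (t <= i)%N -> x 0 i = 0) ->
  forall i : 'I_n.+1, (t < i)%N -> grad chain x 0 i = 0.
Proof.
move=> xt i ti; rewrite grad_least_squares mxE [X in _ * X](_ : _ = 0) ?mulr0//.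
rewrite mxE big1// => j _; rewrite [chain_mx^T _ _]mxE.
have i0 : (i == ord0) = false.
  by rewrite -val_eqE /= gtn_eqF// (leq_trans _ ti).
case: (unliftP ord0 j) => [k|] ->; last first.
  by rewrite [chain_mx _ _]mxE eqxx i0 !mulr0.
have [tk|kt] := leqP t k.
  suff -> : (x *m chain_mx - chain_target) 0 (lift ord0 k) = 0 by rewrite mul0r.
  rewrite mxE mul_chain_mxS mxE chain_targetS.
  by rewrite !xt ?subrr ?oppr0 ?addr0// lift0 ltnW.
rewrite [chain_mx _ _]mxE lift_eqF -!val_eqE /= add0n inordK ?ltnS 1?ltnW//.
rewrite !gtn_eqF ?subrr ?mulr0//; first exact: leq_ltn_trans ti.
exact: ltn_trans ti.
Qed.

Lemma Teps_chain_ge (eps : R) (A : @algorithm R) : 0 <= eps -> A_zr A ->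
  eps ^+ 2 * (n.+1%:R * (a ^- 2 + n%:R) ^+ 2) < (lam * s) ^+ 2 ->
  (n.+2%:R%:E <= Teps eps A chain)%E.
Proof.
move=> eps0 Azr eps_lt.
(* The iterate of index [t] is supported on the first [t] coordinates. *)
have zero t (i : 'I_n.+1) : (t <= i)%N -> A n chain t 0 i = 0.
  elim/ltn_ind: t i => t IH i ti; apply/eqP/negPn/negP => xi.
  have [r rt] := Azr n chain t i xi; rewrite /supp/=.
  by rewrite (supp_grad_chain _ r) ?eqxx//; [exact: IH|exact: leq_trans rt _].
apply/ereal_infP => _ [t /= gt <-]; rewrite lee_fin ler_nat ltnS ltnNge.
apply/negP => tn; move: eps_lt; apply/negP; rewrite -leNgt.
apply: le_trans (grad_chain_ge _ (zero t ord_max tn)) _.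
rewrite mulrC; apply: ler_wpM2r; last by rewrite -eucl_norm_le.
by rewrite mulr_ge0// sqr_ge0.
Qed.

End Chain.

(** * Bounds on the complexities *)

Section ComplexityBounds.
Context {R : realType}.
Implicit Types (eps X L Delta D : R) (F : @function_class R).

Lemma complexity_ge eps AA F (X : \bar R) :
  (forall A, AA A -> exists n (f : 'rV[R]_n.+1 -> R),
     F n f /\ (X <= Teps eps A f)%E) ->
  (X <= complexity eps AA F)%E.
Proof.
move=> hard; apply/ereal_infP => _ [A AA_A <-].
have [n [f [Ff XA]]] := hard A AA_A.
apply: le_trans XA _; apply: ereal_sup_ubound; exists n => //.
by exists f.
Qed.

Lemma complexity_mono eps AA F F' :
  (forall n, F n `<=` F' n) ->
  (complexity eps AA F <= complexity eps AA F')%E.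
Proof.
move=> FF'; apply/ereal_infP => _ [A AA_A <-].
apply: (@le_trans _ _ (ereal_sup (\bigcup_n [set Teps eps A f | f in F n]))).
  by apply: ereal_inf_lbound; exists A.
apply: ereal_sup_le => _ [n _ [f Ff <-]].
by exists n => //; exists f => //; exact: FF'.
Qed.

Lemma Teps_ge1 eps (A : algorithm) n (f : 'rV[R]_n.+1 -> R) :
  (1%:E <= Teps eps A f)%E.
Proof. by apply/ereal_infP => _ [t _ <-]; rewrite lee_fin ler1n. Qed.

(** The dimension [n + 1] of the hard instance is the largest integer below [X];
    when [X <= 1] any dimension will do, since [Teps] is always at least 1. *)
Lemma exists_nat_below X :
  exists n : nat, X <= n.+2%:R /\ (n.+1%:R < X \/ X <= 1).
Proof.
have : exists k : nat, X <= k.+1%:R.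
  exists (Num.Def.truncn `|X|); apply: le_trans (ler_norm X) _.
  by rewrite ltW// truncnS_gt.
move=> exk; case: (ex_minnP exk) => -[|n] Xn minn.
  by exists 0%N; split; [apply: le_trans Xn _; rewrite ler_nat|right].
exists n; split=> //; left; rewrite ltNge; apply/negP => /minn.
by rewrite ltnn.
Qed.

(** It suffices to exhibit in [F], for each dimension [n + 1], a chain whose
    gradients remain above [eps] for [n + 1] steps whenever [n + 1 < X]. *)
Lemma zr_complexity_ge eps X F : 0 <= eps ->
  (forall n, exists lam a s : R, [/\ 0 < lam, 0 < a, F n (chain lam a s) &
     n.+1%:R < X ->
     eps ^+ 2 * (n.+1%:R * (a ^- 2 + n%:R) ^+ 2) < (lam * s) ^+ 2]) ->
  (X%:E <= complexity eps A_zr F)%E.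
Proof.
move=> eps0 hard; have [n [Xn2 nX]] := exists_nat_below X.
have [lam [a [s [lam0 a0 Fchain lt_eps]]]] := hard n.
apply: complexity_ge => A Azr; exists n, (chain lam a s); split => //.
case: nX => [/lt_eps {}lt_eps|X1].
- apply: le_trans (Teps_chain_ge _ _ _ a0 _ _ eps0 Azr lt_eps).
  by rewrite lee_fin.
- by apply: le_trans (Teps_ge1 _ _ _ _); rewrite lee_fin.
Qed.

Lemma Fconv_orth_ext Delta L n N (V : 'M[R]_(n.+1, N.+1)) f :
  0 <= L -> row_orthonormal V -> @Qconv R Delta L n f ->
  @Fconv R Delta L N (orth_ext L V f).
Proof.
move=> L0 oV [[fs fc fL fgap] fq]; split.
- exact/smooth_quadratic/quadratic_orth_ext.
- exact: convex_orth_ext.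
- exact: lipschitz_orth_ext.
- exact: gap_orth_ext.
Qed.

Lemma Fconv_dist_orth_ext D L n N (V : 'M[R]_(n.+1, N.+1)) f :
  0 < L -> row_orthonormal V -> @Qconv_dist R D L n f ->
  @Fconv_dist R D L N (orth_ext L V f).
Proof.
move=> L0 oV [[fs fc fL fdist] fq]; split.
- exact/smooth_quadratic/quadratic_orth_ext.
- exact: (convex_orth_ext _ _ _ (ltW L0)).
- exact: (lipschitz_orth_ext _ _ _ (ltW L0)).
- exact: dist_orth_ext.
Qed.

(** With [lam = L / 4], [a^2 = 1 / T] and [s^2 = 8 Delta T / L], where [T] is
    the dimension, the gap of the chain at 0 is exactly [Delta]. *)
Lemma Qconv_chain_ge eps Delta L : 0 < eps -> 0 < Delta -> 0 < L ->
  ((Num.sqrt (L * Delta) / 4 * eps^-1)%:E <=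
     complexity eps A_zr (Qconv Delta L))%E.
Proof.
move=> eps0 Delta0 L0; apply: zr_complexity_ge => [|n]; first exact: ltW.
set T : R := n.+1%:R; have T1 : 1 <= T by rewrite ler1n.
have T0 : 0 < T by exact: lt_le_trans T1.
pose a := (Num.sqrt T)^-1; pose s := Num.sqrt (8 * Delta * T / L).
have a0 : 0 < a by rewrite invr_gt0 sqrtr_gt0.
have a2 : a ^+ 2 = T^-1 by rewrite exprVn sqr_sqrtr// ltW.
have s2 : s ^+ 2 = 8 * Delta * T / L.
  by rewrite sqr_sqrtr// divr_ge0 ?mulr_ge0 ?ltW.
have lam0 : 0 < L / 4 by rewrite divr_gt0.
have a1 : a <= 1 by rewrite -(@expr_le1 _ 2%N) ?(ltW a0)// a2 invf_le1.
exists (L / 4), a, s; split=> //.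
  split; last exact: quadratic_chain; split.
  - exact/smooth_quadratic/quadratic_chain.
  - exact: convex_chain.
  - rewrite -[L in lipschitz_grad L](divfK (_ : 4 != 0))//.
    exact: lipschitz_chain.
  - apply: gap_chain => //; rewrite exprMn a2 s2 le_eqVlt; apply/orP; left.
    by apply/eqP; field; rewrite !gt_eqF.
rewrite -/T => TX.
have {}TX : 16 * (eps ^+ 2 * T ^+ 2) < L * Delta.
  have : (4 * (eps * T)) ^+ 2 < Num.sqrt (L * Delta) ^+ 2.
    rewrite ltr_pXn2r ?nnegrE ?sqrtr_ge0 ?mulr_ge0 ?ltW//.
    move: TX; rewrite !ltr_pdivlMr//.
    by rewrite (_ : 4 * _ = T * eps * 4)//; ring.
  by rewrite sqr_sqrtr ?mulr_ge0 ?ltW// !exprMn -natrX.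
have -> : a ^- 2 = T by rewrite a2 invrK.
rewrite exprMn s2 (_ : (L / 4) ^+ 2 * _ = T * (L * Delta / 2));
  last by field; rewrite gt_eqF.
rewrite mulrCA ltr_pM2l//.
have nT : n%:R = T - 1 by rewrite /T -natr1 addrK.
rewrite nT.
have : (T + (T - 1)) ^+ 2 <= 4 * T ^+ 2 by nra.
have e2 : 0 < eps ^+ 2 by rewrite exprn_gt0.
rewrite -(ler_pM2l e2); have : 0 < L * Delta by rewrite mulr_gt0.
lra.
Qed.

(** With [lam = L / 4], [a = 1] and [s^2 = D^2 / T], where [T] is the dimension,
    the only minimizer of the chain, constant equal to [s], has norm [D]. *)
Lemma Qconv_dist_chain_ge eps D L : 0 < eps -> 0 < D -> 0 < L ->
  ((Num.sqrt (L * D) / 2 * eps `^ (- 2^-1))%:E <=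
     complexity eps A_zr (attaining (Qconv_dist D L)))%E.
Proof.
move=> eps0 D0 L0; apply: zr_complexity_ge => [|n]; first exact: ltW.
set T : R := n.+1%:R; have T0 : 0 < T by rewrite ltr0n.
pose s := D / Num.sqrt T.
have s2 : s ^+ 2 = D ^+ 2 / T by rewrite exprMn exprVn sqr_sqrtr// ltW.
have lam0 : 0 < L / 4 by rewrite divr_gt0.
exists (L / 4), 1, s; split=> //.
  split; last by rewrite /= argmin_chain//; exists (const_mx s).
  split; last exact: quadratic_chain; split.
  - exact/smooth_quadratic/quadratic_chain.
  - exact: convex_chain.
  - rewrite -[L in lipschitz_grad L](divfK (_ : 4 != 0))//.
    exact: lipschitz_chain.
  - apply: dist_chain => //; first exact: ltW.
    by rewrite s2 mulrC divfK// gt_eqF.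
rewrite -/T => TX.
have {}TX : 4 * (eps * T ^+ 2) < L * D.
  have : T ^+ 2 < (Num.sqrt (L * D) / 2 * eps `^ (- 2^-1)) ^+ 2.
    by rewrite ltr_pXn2r ?nnegrE ?(ltW T0)// ltW// (lt_trans _ TX).
  rewrite powRN powR12_sqrt ?ltW// !exprMn !exprVn !sqr_sqrtr ?mulr_ge0 ?ltW//.
  rewrite ltr_pdivlMr// ltr_pdivlMr ?exprn_gt0//.
  by rewrite (_ : 4 * _ = T ^+ 2 * eps * 2 ^+ 2)//; ring.
have -> : 1 ^- 2 + n%:R = T by rewrite expr1n invr1 addrC natr1.
rewrite exprMn s2 (_ : (L / 4) ^+ 2 * _ = ((L * D) / 4) ^+ 2 / T);
  last by field; rewrite gt_eqF.
rewrite ltr_pdivlMr// (_ : _ * T = (eps * T ^+ 2) ^+ 2); last by ring.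
rewrite ltr_pXn2r ?nnegrE ?divr_ge0 ?mulr_ge0 ?exprn_ge0 ?ltW//.
by rewrite ltr_pdivlMr// mulrC.
Qed.

End ComplexityBounds.

Theorem theorem1 (R : realType) (eps Delta D L1 : R)
    (heps : 0 < eps) (hDelta : 0 < Delta) (hD : 0 < D) (hL1 : 0 < L1) :
  [/\ (complexity eps A_zr (Qconv Delta L1)
         <= complexity eps A_det (Fconv Delta L1))%E,
      ((Num.sqrt (L1 * Delta) / 4 * eps^-1)%:E
         <= complexity eps A_zr (Qconv Delta L1))%E,
      (complexity eps A_zr (Qconv_dist D L1)
         <= complexity eps A_det (Fconv_dist D L1))%E &
      ((Num.sqrt (L1 * D) / 2 * eps `^ (- 2^-1))%:E
         <= complexity eps A_zr (Qconv_dist D L1))%E]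
  /\
  (complexity eps A_zr (attaining (Qconv_dist D L1))
     <= complexity eps A_det (attaining (Fconv_dist D L1)))%E
  /\
  ((Num.sqrt (L1 * D) / 2 * eps `^ (- 2^-1))%:E
     <= complexity eps A_zr (attaining (Qconv_dist D L1)))%E.
Proof.
have hardD := Qconv_dist_chain_ge eps D L1 heps hD hL1.
split; last split=> //; first split.
- apply: (complexity_zr_le_det _ L1) => [n f []//|n N V f oV Ff].
  by apply: Fconv_orth_ext => //; exact: ltW.
- exact: Qconv_chain_ge.
- apply: (complexity_zr_le_det _ L1) => [n f []//|n N V f oV Ff].
  exact: Fconv_dist_orth_ext.
- by apply: le_trans hardD _; apply: complexity_mono => n f [].
- apply: (complexity_zr_le_det _ L1) => [n f [[]]//|n N V f oV [Ff minf]].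
  split; first exact: Fconv_dist_orth_ext.
  by apply: argmin_orth_ext => //; exact: ltW.
Qed.
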